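(* Let $P_1$ be a partial algorithm from natural numbers to $\{0,1\}$ that is not extendable to a totally defined algorithm, let $P_2$ be the algorithm that runs $P_1$ one step late, and for each natural number $n$ let $b_n^1$ and $b_n^2$ be the constructive real numbers built from $P_1$ and $P_2$ as in the context. Let $p$ and $q$ be rational numbers such that $p<q$. Then it is undecidable whether $M_p(b_n^1,b_n^2)=M_q(b_n^1,b_n^2)$ or $M_p(b_n^1,b_n^2)<M_q(b_n^1,b_n^2)$; that is, there is no algorithm which, for every natural number $n$, terminates and correctly decides which of these two relations holds.
   Context: ''Algorithm'' means a (partial) computable function on natural numbers given by a program; ''totally defined'' means that it terminates on every input. $P_1$ is a partially defined algorithm taking values in $\{0,1\}$ such that no total computable function $\mathbb{N}\to\{0,1\}$ agrees with $P_1$ on the whole domain of $P_1$. A program computing $P_1$ is fixed, so that one can check effectively whether $P_1$ has finished working on input $n$ by step $k$; if $P_1$ terminates on $n$, it finishes at a definite step. $P_2$ is the algorithm that runs $P_1$ one step late on the same input: if $P_1$ terminates on input $n$ at step $i$, then $P_2$ terminates on input $n$ at step $i+1$ (with the same output), and if $P_1$ does not terminate on $n$, then neither does $P_2$. A constructive real number (CRN) is a pair of algorithms $(A,B)$, where $A$ transforms natural numbers into rational numbers and $B$ transforms natural numbers into natural numbers, such that for every integer $n>0$ and all $i,j\ge B(n)$ one has $|A(i)-A(j)|<2^{-n}$. If the CRN is denoted $x$, then $x(k)$ denotes $A(k)$; its value is the real number $\lim_k x(k)$, and equalities and inequalities between CRNs, and between expressions in them, refer to these values. Power mean: for positive reals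 $x_1,\dots,x_r$ and real $p\neq 0$, $M_p(x_1,\dots,x_r)=\left(\frac{x_1^p+\cdots+x_r^p}{r}\right)^{1/p}$, and $M_0(x_1,\dots,x_r)=\sqrt[r]{x_1\cdots x_r}$ (the geometric mean). Construction: for each natural $n$ and each $i\in\{1,2\}$, $b_n^i$ is the CRN whose sequence of rationals is $b_n^i(k)=5+2^{-k}$ if $P_i$ has not yet finished working on input $n$ by step $k$, and $b_n^i(k)=5+2^{-l}$ if $P_i$ has finished working on $n$ by step $k$, where $l$ is the step number at which $P_i$ finished working. (These sequences converge in themselves at geometric speed, so they give CRNs.) *)

(* Defs.v *)
From HB Require Import structures.
From mathcomp Require Import all_boot all_order all_algebra.
From mathcomp Require Import all_classical all_reals all_analysis.
From mathcomp Require Import ring lra zify.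

Set Implicit Arguments.
Unset Strict Implicit.
Unset Printing Implicit Defensive.

Import Order.TTheory GRing.Theory Num.Theory.
Import numFieldNormedType.Exports.

(* Algorithms are programs of the WHILE language IMP over registers that hold
   natural numbers, with the usual small-step semantics, one transition being
   one step of work. *)

Inductive expr :=
| Const of nat
| Var of nat
| Plus of expr & expr
| Minus of expr & expr
| Mult of expr & expr.

Inductive com :=
| Skip
| Assign of nat & expr
| Seq of com & com
| If of expr & com & com
| While of expr & com.

Definition store := nat -> nat.

Definition update (s : store) (x v : nat) : store :=
  fun y => if y == x then v else s y.

(* [Minus] is truncated subtraction. *)
Fixpoint eval (s : store) (e : expr) : nat :=
  match e with
  | Const n => n
  | Var x => s x
  | Plus e1 e2 => eval s e1 + eval s e2
  | Minus e1 e2 => eval s e1 - eval s e2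
  | Mult e1 e2 => eval s e1 * eval s e2
  end.

Definition is_skip (c : com) : bool := if c is Skip then true else false.

(* A guard counts as true when its value is nonzero.  [Skip] is the terminal
   command: a terminated configuration no longer changes. *)
Fixpoint step (c : com) (s : store) : com * store :=
  match c with
  | Skip => (Skip, s)
  | Assign x e => (Skip, update s x (eval s e))
  | Seq c1 c2 =>
      if is_skip c1 then (c2, s)
      else let r := step c1 s in (Seq r.1 c2, r.2)
  | If e c1 c2 => (if eval s e != 0 then c1 else c2, s)
  | While e c1 => (if eval s e != 0 then Seq c1 c else Skip, s)
  end.

Definition steps (k : nat) (cs : com * store) : com * store :=
  iter k (fun cs => step cs.1 cs.2) cs.

(* The input is placed in register 0, all other registers being 0, and the
   output is read from register 0. *)
Definition init (n : nat) : store := fun x => if x == 0 then n else 0.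

Definition finished_by (P : com) (n k : nat) : bool :=
  is_skip (steps k (P, init n)).1.

Definition finishes_at (P : com) (n i v : nat) : Prop :=
  [/\ finished_by P n i,
      forall j, j < i -> ~~ finished_by P n j &
      (steps i (P, init n)).2 0 = v].

Definition outputs (P : com) (n v : nat) : Prop :=
  exists i, finishes_at P n i v.

Definition terminates (P : com) (n : nat) : Prop := exists v, outputs P n v.

Definition computable (f : nat -> nat) : Prop :=
  exists P, forall n, outputs P n (f n).

Definition binary_valued (P : com) : Prop :=
  forall n v, outputs P n v -> v = 0 \/ v = 1.

Definition extendable (P : com) : Prop :=
  exists f : nat -> bool, computable (fun n => nat_of_bool (f n)) /\
    forall n v, outputs P n v -> v = f n.

Definition one_step_late (P1 P2 : com) : Prop :=
  (forall n i v, finishes_at P1 n i v -> finishes_at P2 n i.+1 v) /\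
  (forall n, ~ terminates P1 n -> ~ terminates P2 n).

Lemma one_step_late_Skip P : one_step_late P (Seq Skip P).
Proof.
have E n k : steps k.+1 (Seq Skip P, init n) = steps k (P, init n).
  by rewrite /steps iterSr.
split=> [n i v [fi lti vi]|n nP [v [[|i] [fi lti vi]]]].
- split; rewrite /finished_by ?E //.
  by case=> [|j] // ji; rewrite E; apply: lti.
- by [].
- apply: nP; exists v, i; split; rewrite /finished_by -?E //.
  by move=> j ji; rewrite -E; apply: lti.
Qed.

Local Open Scope ring_scope.

(* A sequence of rationals is computable when signs, numerators and
   denominators are. *)
Definition computable_rat (A : nat -> rat) : Prop :=
  exists s a d : nat -> nat,
    [/\ computable s, computable a, computable d &
        forall k, A k = (-1) ^+ s k * (a k)%:R / (d k).+1%:R].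

Record CRN := MkCRN {
  crn_seq :> nat -> rat;
  crn_mod : nat -> nat;
  crn_seq_computable : computable_rat crn_seq;
  crn_mod_computable : computable crn_mod;
  crn_modP : forall n i j : nat, (0 < n)%N ->
    (crn_mod n <= i)%N -> (crn_mod n <= j)%N ->
    `|crn_seq i - crn_seq j| < 2%:R ^- n
}.

Definition crn_val (R : realType) (x : CRN) : R :=
  limn (fun k => ratr (x k) : R).

Definition power_mean (R : realType) (p : R) (x : seq R) : R :=
  if p == 0 then (\prod_(a <- x) a) `^ (size x)%:R^-1
  else ((\sum_(a <- x) a `^ p) / (size x)%:R) `^ p^-1.

(* When [P] has finished on [n] by step [k], this is the step at which it
   finished. *)
Definition finish_step (P : com) (n k : nat) : nat :=
  find (finished_by P n) (iota 0 k.+1).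

Definition b_seq (P : com) (n k : nat) : rat :=
  if finished_by P n k then 5%:R + 2%:R ^- finish_step P n k
  else 5%:R + 2%:R ^- k.

Local Close Scope ring_scope.

Lemma finished_byS P n j k : j <= k -> finished_by P n j -> finished_by P n k.
Proof.
move/subnK <-; elim: (k - j) => // m IH /IH.
by rewrite /finished_by /steps addSn iterS; case: (iter _ _ _) => -[].
Qed.

Lemma finish_stepE P n l k : finished_by P n l ->
  (forall j, j < l -> ~~ finished_by P n j) -> l <= k ->
  finish_step P n k = l.
Proof.
move=> fl ltl lk; rewrite /finish_step.
have -> : k.+1 = l + (k - l).+1 by lia.
rewrite iotaD find_cat size_iota add0n /= fl addn0 ifF //.
apply/negbTE/hasPn => j; rewrite mem_iota add0n => /andP[_]; exact: ltl.
Qed.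

Definition stop_fun (m : nat -> nat) : Prop :=
  (forall k, m k = k) \/ exists l, forall k, m k = minn k l.

Lemma b_seqE P n : exists2 m, stop_fun m &
  forall k, b_seq P n k = (5%:R + 2%:R ^- m k)%R.
Proof.
case: (pselect (exists l, finished_by P n l)) => [ex|nex].
- case: (ex_minnP ex) => l fl minl.
  have ltl j : j < l -> ~~ finished_by P n j.
    by move=> jl; apply/negP => /minl; rewrite leqNgt jl.
  exists (fun k => minn k l); first by right; exists l.
  move=> k; rewrite /b_seq; case: ifPn => fk.
    by rewrite (finish_stepE fl) ?minl //; have := minl _ fk => /minn_idPr ->.
  suff /minn_idPl -> : k <= l by [].
  by rewrite leqNgt; apply/negP => /ltnW lk; rewrite (finished_byS lk fl) in fk.
- exists id; first by left.
  by move=> k; rewrite /b_seq ifN //; apply/negP => fk; apply: nex; exists k.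
Qed.

Definition runs_to (c : com) (s s' : store) : Prop :=
  exists k, steps k (c, s) = (Skip, s').

Lemma runs_to_step c s s' :
  runs_to (step c s).1 (step c s).2 s' -> runs_to c s s'.
Proof.
by case=> k E; exists k.+1; rewrite /steps iterSr /=; move: E; case: (step c s).
Qed.

Lemma runs_to_Seq c1 c2 s s' s'' :
  runs_to c1 s s' -> runs_to c2 s' s'' -> runs_to (Seq c1 c2) s s''.
Proof.
move=> [k E] r2; elim: k c1 s E => [|k IH] c1 s.
  by case=> -> ->; apply: runs_to_step.
rewrite /steps iterSr /= => E; apply: runs_to_step => /=.
case: ifP => sk /=; last by apply: IH; rewrite -surjective_pairing.
case: c1 sk E => // _ E; have Hs j : steps j (Skip, s) = (Skip, s).
  by elim: j => // j IHj; rewrite /steps iterS -/(steps j _) IHj.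
by move: E; rewrite -/(steps k _) Hs => -[->].
Qed.

Lemma runs_to_Assign x e s : runs_to (Assign x e) s (update s x (eval s e)).
Proof. by exists 1%N. Qed.

Lemma runs_to_outputs P n s : runs_to P (init n) s -> outputs P n (s 0).
Proof.
move=> [k E].
have ex : exists k, finished_by P n k by exists k; rewrite /finished_by E.
case: (ex_minnP ex) => i fi mini; exists i; split => //.
  by move=> j ji; apply/negP => /mini; rewrite leqNgt ji.
have ik : i <= k by apply: mini; rewrite /finished_by E.
suff E' : steps k (P, init n) = steps i (P, init n) by rewrite -E' E.
rewrite -(subnK ik) /steps iterD; move: fi; rewrite /finished_by /steps.
by case: (iter i _ _) => -[] // t _; elim: (k - i) => //= a ->.
Qed.

Lemma computable_pow2 (m : nat -> nat) (e : expr) (g : nat -> nat) :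
  stop_fun m -> (forall s, eval s e = g (s 1)) ->
  computable (fun k => g (2 ^ m k)).
Proof.
move=> hm he.
have [em hem] : exists em, forall s, eval s em = m (s 0).
  case: hm => [hm|[l hm]]; first by exists (Var 0) => s; rewrite hm.
  exists (Minus (Var 0) (Minus (Var 0) (Const l))) => s; rewrite hm /=; lia.
pose body := Seq (Assign 1 (Mult (Const 2) (Var 1)))
                 (Assign 0 (Minus (Var 0) (Const 1))).
exists (Seq (Assign 0 em) (Seq (Assign 1 (Const 1))
         (Seq (While (Var 0) body) (Assign 0 e)))) => k.
have loop s : exists2 s', runs_to (While (Var 0) body) s s' &
    s' 1 = s 1 * 2 ^ s 0.
  have [a] := ubnP (s 0); elim: a s => // a IH s sa.
  have [s0|s0] := eqVneq (s 0) 0.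
    exists s; last by rewrite s0 expn0 muln1.
    by apply: runs_to_step; rewrite /= s0; exists 0.
  set s1 := update (update s 1 (2 * s 1)) 0 (s 0 - 1).
  have [|s' r E] := IH s1; first by rewrite /s1 /update /=; lia.
  exists s'.
    apply: runs_to_step; rewrite /= s0; apply: runs_to_Seq r.
    by apply: runs_to_Seq; apply: runs_to_Assign.
  rewrite E /s1 /update /= mulnC mulnCA mulnC -mulnA mulnC.
  by case: (s 0) s0 => // b _; rewrite subn1 expnS /=; lia.
set s1 := update (init k) 0 (eval (init k) em).
set s2 := update s1 1 1.
have [s3 r3 E3] := loop s2.
have -> : g (2 ^ m k) = update s3 0 (eval s3 e) 0.
  by rewrite /update /= he E3 /s2 /update /= /s1 /update /= hem mul1n.
apply: runs_to_outputs.
by do 3?[apply: runs_to_Seq; first by [exact: runs_to_Assign|exact: r3]];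
  apply: runs_to_Assign.
Qed.

Lemma computable_const c : computable (fun=> c).
Proof.
exists (Assign 0 (Const c)) => n.
exact: runs_to_outputs (runs_to_Assign _ _ _).
Qed.

Lemma computable_id : computable id.
Proof. by exists Skip => n; apply: (@runs_to_outputs _ _ (init n)); exists 0. Qed.

Lemma b_seq_computable P n : computable_rat (b_seq P n).
Proof.
have [m hm E] := b_seqE P n.
exists (fun=> 0), (fun k => 5 * 2 ^ m k + 1), (fun k => 2 ^ m k - 1); split.
- exact: computable_const.
- exact: (@computable_pow2 m (Plus (Mult (Const 5) (Var 1)) (Const 1))
    (fun x => 5 * x + 1)).
- exact: (@computable_pow2 m (Minus (Var 1) (Const 1)) (fun x => x - 1)).
- move=> k; rewrite E expr0 mul1r.
  have p2 : 0 < 2 ^ m k by rewrite expn_gt0.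
  rewrite subn1 prednK // natrD natrM natrX.
  by field; rewrite expf_neq0.
Qed.

Lemma b_seq_cauchy P n (N i j : nat) : (0 < N)%N ->
  (N <= i)%N -> (N <= j)%N ->
  (`|b_seq P n i - b_seq P n j| < 2%:R ^- N :> rat)%R.
Proof.
move=> _ Ni Nj; have [m hm E] := b_seqE P n; rewrite !E.
have pos k : (0 < 2%:R ^- k :> rat)%R by rewrite invr_gt0 exprn_gt0.
have le k : N <= k -> (2%:R ^- k <= 2%:R ^- N :> rat)%R.
  by move=> Nk; rewrite lef_pV2 ?posrE ?exprn_gt0 // ler_eXn2l // ltr1n.
have [<-|[mi mj]] : m i = m j \/ N <= m i /\ N <= m j.
  by case: hm => [hm|[l hm]]; rewrite !hm; lia.
  by rewrite subrr normr0.
have := (pos (m i), pos (m j), le _ mi, le _ mj).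
by move=> [[[p1 p2] p3] p4]; rewrite ltr_norml; lra.
Qed.

Definition b (P : com) (n : nat) : CRN :=
  MkCRN (b_seq_computable P n) computable_id (@b_seq_cauchy P n).

(* Main.v *)
(* If P_1 halts on n at step l, the two numbers are 5 + 2^-l and 5 + 2^-(l+1),
   which are distinct, so the power means of distinct exponents differ; if it
   does not halt, both numbers and all their means are 5.  An algorithm deciding
   between equality and strict inequality would therefore decide the halting of
   P_1; running P_1 only on the inputs where it is known to halt, and returning 0
   elsewhere, would extend P_1 to a total algorithm.

   Strict monotonicity of the power mean for positive exponents p < q comes from
   Bernoulli's inequality x^w < 1 + w(x - 1) with w = p/q, applied to the q-th
   powers divided by their arithmetic mean; exponent 0 is the AM-GM inequality,
   and negative exponents reduce to positive ones by inverting the numbers. *)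

Require Import Defs.
From mathcomp Require Import all_boot all_order all_algebra.
From mathcomp Require Import all_classical all_reals all_analysis.
From mathcomp Require Import ring lra.
Import Order.TTheory GRing.Theory Num.Theory.
Import numFieldNormedType.Exports.

Set Implicit Arguments.
Unset Strict Implicit.
Unset Printing Implicit Defensive.

(** * Programs confined to finitely many registers *)

Fixpoint expr_regs (K : nat) (e : expr) : bool :=
  match e with
  | Const _ => true
  | Var x => x < K
  | Plus e1 e2 | Minus e1 e2 | Mult e1 e2 => expr_regs K e1 && expr_regs K e2
  end.

Fixpoint com_regs (K : nat) (c : com) : bool :=
  match c with
  | Skip => true
  | Assign x e => (x < K) && expr_regs K e
  | Seq c1 c2 => com_regs K c1 && com_regs K c2
  | If e c1 c2 => [&& expr_regs K e, com_regs K c1 & com_regs K c2]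
  | While e c1 => expr_regs K e && com_regs K c1
  end.

Lemma expr_regs_le K L e : K <= L -> expr_regs K e -> expr_regs L e.
Proof.
move=> KL; elim: e => //= [x xK|e1 IH1 e2 IH2|e1 IH1 e2 IH2|e1 IH1 e2 IH2];
  by [exact: leq_trans KL|case/andP=> /IH1 -> /IH2 ->].
Qed.

Lemma com_regs_le K L c : K <= L -> com_regs K c -> com_regs L c.
Proof.
move=> KL; elim: c => //=.
- by move=> x e /andP[xK /(expr_regs_le KL) ->]; rewrite (leq_trans xK).
- by move=> c1 IH1 c2 IH2 /andP[/IH1 -> /IH2 ->].
- by move=> e c1 IH1 c2 IH2 /and3P[/(expr_regs_le KL) -> /IH1 -> /IH2 ->].
- by move=> e c IH /andP[/(expr_regs_le KL) -> /IH ->].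
Qed.

Lemma expr_regs_ex e : exists K, expr_regs K e.
Proof.
elim: e => [n|x|e1 [K IH1] e2 [L IH2]|e1 [K IH1] e2 [L IH2]
  |e1 [K IH1] e2 [L IH2]]; first by exists 0.
  by exists x.+1 => /=.
all: by exists (maxn K L); rewrite /= (@expr_regs_le K) ?leq_maxl //
  (@expr_regs_le L) ?leq_maxr.
Qed.

Lemma com_regs_ex c : exists K, com_regs K c.
Proof.
elim: c => [|x e|c1 [K IH1] c2 [L IH2]|e c1 [K IH1] c2 [L IH2]|e c [K IH]].
- by exists 0.
- have [K eK] := expr_regs_ex e; exists (maxn K x.+1).
  by rewrite /= leq_maxr (@expr_regs_le K) ?leq_maxl.
- by exists (maxn K L); rewrite /= (@com_regs_le K) ?leq_maxl //
    (@com_regs_le L) ?leq_maxr.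
- have [M eM] := expr_regs_ex e; exists (maxn M (maxn K L)).
  rewrite /= (@expr_regs_le M) ?leq_maxl // (@com_regs_le K) //.
    by rewrite (@com_regs_le L) // leq_max leq_maxr orbT.
  by rewrite leq_max leq_maxl orbT.
- have [M eM] := expr_regs_ex e; exists (maxn M K).
  by rewrite /= (@expr_regs_le M) ?leq_maxl // (@com_regs_le K) ?leq_maxr.
Qed.

Definition agree (K : nat) (s t : store) : Prop := forall x, x < K -> s x = t x.

Lemma eval_agree K e s t : agree K s t -> expr_regs K e -> Defs.eval s e = Defs.eval t e.
Proof.
move=> st.
elim: e => //= [e1 IH1 e2 IH2|e1 IH1 e2 IH2|e1 IH1 e2 IH2] /andP[];
  by move=> /IH1 -> /IH2 ->.
Qed.

Lemma step_agree K c s t : agree K s t -> com_regs K c ->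
  [/\ (step c s).1 = (step c t).1, agree K (step c s).2 (step c t).2,
      com_regs K (step c t).1 & forall x, K <= x -> (step c t).2 x = t x].
Proof.
move=> st; elim: c => //=.
- move=> x e /andP[xK eK]; split=> // y yK.
    by rewrite /update; case: ifP => _; [exact: eval_agree eK|exact: st].
  by rewrite /update ifF //; apply/eqP => yx; rewrite yx leqNgt xK in yK.
- move=> c1 IH1 c2 IH2 /andP[/IH1[E1 E2 E3 E4] c2K].
  by case: ifP => //= _; rewrite E1 E3 c2K.
- move=> e c1 _ c2 _ /and3P[eK c1K c2K]; rewrite (eval_agree st eK).
  by split=> //; case: ifP.
- move=> e c _ /andP[eK cK]; rewrite (eval_agree st eK).
  by split=> //; case: ifP => //= _; rewrite eK cK.
Qed.

(** Lets a program run as a subroutine: whatever registers from [K] on contain cannot influence it,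
    and data saved there survives the run. *)
Lemma runs_to_agree K c s t s' : agree K s t -> com_regs K c ->
  runs_to c s s' ->
  exists t', [/\ runs_to c t t', agree K s' t' & forall x, K <= x -> t' x = t x].
Proof.
move=> st cK [k]; elim: k c s t st cK => [|k IH] c s t st cK.
  by case=> -> <-; exists t; split => //; exists 0.
rewrite /steps iterSr /=; have [E1 E2 E3 E4] := step_agree st cK.
case Es : (step c s) E1 E2 => [d u] /= E1 E2; rewrite E1 => r.
have [t' [r' a' f']] := IH _ _ _ E2 E3 r.
exists t'; split=> //; first exact: runs_to_step.
by move=> x Kx; rewrite f' // E4.
Qed.

(** * From a halting decider to a total extension *)

Lemma outputs_runs_to P n v : outputs P n v ->
  exists2 s, runs_to P (init n) s & s 0 = v.
Proof.
case=> i [+ _ <-]; rewrite /finished_by.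
case E : (steps i _) => [[] s] //= _; exists s => //; by exists i.
Qed.

Lemma outputs_inj P n v w : outputs P n v -> outputs P n w -> v = w.
Proof.
move=> [i [fi li <-]] [j [fj lj <-]].
suff -> : i = j by [].
case: (ltngtP i j) => // ij; last by have := li _ ij; rewrite fj.
by have := lj _ ij; rewrite fi.
Qed.

Lemma runs_to_If e c1 c2 s s' :
  runs_to (if Defs.eval s e != 0 then c1 else c2) s s' -> runs_to (If e c1 c2) s s'.
Proof. by move=> r; apply: runs_to_step. Qed.

(** [P] expects zeros outside register 0, as in [init], whereas the run of [D] leaves its own values
    behind. *)
Fixpoint clear (K : nat) : com :=
  if K is K'.+1 then Seq (clear K') (Assign K' (Const 0)) else Skip.

Lemma runs_to_clear K s :
  runs_to (clear K) s (fun x => if x < K then 0 else s x).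
Proof.
elim: K => [|K IH] /=; first by exists 0.
have -> : (fun x => if x < K.+1 then 0 else s x) =
    update (fun x => if x < K then 0 else s x) K 0.
  by apply/funext => x; rewrite /update ltnS; case: ltngtP.
exact: runs_to_Seq IH (runs_to_Assign _ _ _).
Qed.

(* Register [K], which neither [D] nor [P] uses, keeps the input while [D]
   runs. *)
Definition guarded (K : nat) (D P : com) : com :=
  Seq (Assign K (Var 0)) (Seq D
    (If (Var 0) (Seq (clear K) (Seq (Assign 0 (Var K)) P)) Skip)).

Lemma guarded_outputs0 K D P n : 0 < K -> com_regs K D -> outputs D n 0 ->
  outputs (guarded K D P) n 0.
Proof.
move=> K0 DK /outputs_runs_to[s Ds s0].
have ag : agree K (init n) (update (init n) K n).
  by move=> x xK; rewrite /update ifF // ltn_eqF.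
have [t [Dt st _]] := runs_to_agree ag DK Ds.
rewrite -s0 (st 0 K0); apply: runs_to_outputs.
apply: runs_to_Seq (runs_to_Assign _ _ _) _; apply: runs_to_Seq Dt _.
by apply: runs_to_If; rewrite /= -(st 0 K0) s0; exists 0.
Qed.

Lemma guarded_outputs K D P n u v : 0 < K -> com_regs K D -> com_regs K P ->
  outputs D n u -> u != 0 -> outputs P n v -> outputs (guarded K D P) n v.
Proof.
move=> K0 DK PK /outputs_runs_to[s Ds su] u0 /outputs_runs_to[s' Ps' <-].
have ag : agree K (init n) (update (init n) K n).
  by move=> x xK; rewrite /update ifF // ltn_eqF.
have [t [Dt st tf]] := runs_to_agree ag DK Ds.
(* Below [K] this store coincides with [init n]; the copy of the input still held in register [K] is
   harmless, since [P] stays below [K]. *)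
set t1 := update (fun x => if x < K then 0 else t x) 0 n.
have ag1 : agree K (init n) t1 by move=> x xK; rewrite /t1 /update xK.
have [t' [Pt' s't' _]] := runs_to_agree ag1 PK Ps'.
rewrite (s't' 0 K0); apply: runs_to_outputs.
apply: runs_to_Seq (runs_to_Assign _ _ _) _; apply: runs_to_Seq Dt _.
apply: runs_to_If; rewrite /= -(st 0 K0) su u0.
apply: runs_to_Seq (runs_to_clear _ _) _.
by apply: runs_to_Seq (runs_to_Assign _ _ _) _;
  rewrite /= ltnn tf // /update eqxx.
Qed.

Lemma decidable_halting_extendable P D : binary_valued P ->
  (forall n, (outputs D n 0 /\ ~ terminates P n) \/
             (outputs D n 1 /\ terminates P n)) ->
  extendable P.
Proof.
move=> binP decD.
have [[K0 DK0] [L0 PL0]] := (com_regs_ex D, com_regs_ex P).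
(* The successor keeps [K] positive, so that register 0, which carries input and output, is among
   the registers on which the stores agree. *)
pose K := (maxn K0 L0).+1.
have DK : com_regs K D by apply: com_regs_le DK0; rewrite leqW ?leq_maxl.
have PK : com_regs K P by apply: com_regs_le PL0; rewrite leqW ?leq_maxr.
(* This [f] is chosen classically and is 0 wherever [P] diverges; its computability comes from
   [guarded K D P]. *)
pose f n := `[< outputs P n 1 >].
have fP n v : outputs P n v -> v = f n.
  move=> Pv; rewrite /f; case: asboolP => [/(outputs_inj Pv) //|].
  by have [->|v1] := binP n v Pv; last by rewrite -v1.
exists f; split=> //; exists (guarded K D P) => n.
have [[D0 nP]|[D1 [v Pv]]] := decD n.
  suff -> : f n = false by apply: guarded_outputs0.
  by apply/asboolPn => P1; apply: nP; exists 1.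
by rewrite -(fP n v Pv); apply: guarded_outputs D1 _ Pv.
Qed.

Local Open Scope ring_scope.

(** * Strict monotonicity of two-variable power means in the exponent *)

Lemma ln_lt_subr1 (R : realType) (x : R) : 0 < x -> x != 1 -> ln x < x - 1.
Proof.
move=> x0 x1; rewrite -ltr_expR lnK ?posrE //.
by rewrite -[X in X < _](subrKC 1 x) expR_gt1Dx // subr_eq0.
Qed.

(** Strict concavity of the logarithm, by its tangent at [A], the mean of [x] and 1 with weights [w]
    and [1 - w]. The tangent bounds at [x] and at 1, taken with these weights, add up to 0 on the
    right; the bound at 1 is strict because [A != 1]. *)
Lemma powR_lt1Dx (R : realType) (x w : R) : 0 < x -> x != 1 -> 0 < w < 1 ->
  x `^ w < 1 + w * (x - 1).
Proof.
move=> x0 x1 /andP[w0 w1]; set A := 1 + _.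
have A0 : 0 < A by rewrite /A; nra.
have A1 : A != 1.
  by rewrite -subr_eq0 addrAC subrr add0r mulf_neq0 ?subr_eq0 // gt_eqF.
have lnA : - ln A < A^-1 - 1.
  by rewrite -lnV ?posrE // ln_lt_subr1 ?invr_gt0 // invr_eq1.
have lnxA : ln x - ln A <= x / A - 1.
  rewrite -ln_div ?posrE // -[X in ln X](subrKC 1 (x / A)) le_ln1Dx //.
  by rewrite ltrBrDl subrr divr_gt0.
have E : w * (x / A - 1) + (1 - w) * (A^-1 - 1) = 0.
  by rewrite /A; field; rewrite gt_eqF.
rewrite -ltr_ln ?posrE ?powR_gt0 // ln_powR.
by nra.
Qed.

Lemma power_mean_pairE (R : realType) (r a b : R) : r != 0 ->
  power_mean r [:: a; b] = ((a `^ r + b `^ r) / 2) `^ r^-1.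
Proof. by move=> /negbTE r0; rewrite /power_mean r0 !big_cons big_nil addr0. Qed.

Lemma power_mean0_pairE (R : realType) (a b : R) :
  power_mean 0 [:: a; b] = (a * b) `^ 2^-1.
Proof. by rewrite /power_mean eqxx !big_cons big_nil mulr1. Qed.

Lemma power_mean_gt0 (R : realType) (r a b : R) : 0 < a -> 0 < b ->
  0 < power_mean r [:: a; b].
Proof.
move=> a0 b0; have [->|r0] := eqVneq r 0.
  by rewrite power_mean0_pairE powR_gt0 // mulr_gt0.
by rewrite power_mean_pairE // powR_gt0 // divr_gt0 // addr_gt0 // powR_gt0.
Qed.

Lemma powR_invl (R : realType) (x r : R) : 0 <= x ->
  x^-1 `^ r = (x `^ r)^-1.
Proof. by move=> x0; rewrite -powR_inv1 // -powRrM mulN1r powRN. Qed.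

Lemma power_meanV (R : realType) (r a b : R) : 0 < a -> 0 < b ->
  power_mean (- r) [:: a; b] = (power_mean r [:: a^-1; b^-1])^-1.
Proof.
move=> a0 b0; have [->|r0] := eqVneq r 0.
  rewrite oppr0 !power_mean0_pairE -invfM powR_invl ?invrK //.
  by rewrite mulr_ge0 // ltW.
rewrite !power_mean_pairE ?oppr_eq0 // invrN !powRN !powR_invl //; exact: ltW.
Qed.

Lemma power_mean_lt_pos (R : realType) (p q a b : R) :
  0 < a -> 0 < b -> a != b -> 0 < p -> p < q ->
  power_mean p [:: a; b] < power_mean q [:: a; b].
Proof.
move=> a0 b0 ab p0 pq; have q0 : 0 < q by lra.
rewrite !power_mean_pairE ?gt_eqF //.
set A := (_ `^ q + _) / 2.
have aq := powR_gt0 q a0; have bq := powR_gt0 q b0.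
have A0 : 0 < A by rewrite /A; lra.
have w01 : 0 < p / q < 1 by rewrite divr_gt0 //= ltr_pdivrMr // mul1r.
have abq : a `^ q != b `^ q.
  apply: contra ab => /eqP /powR_injective -> //; exact: ltW.
have neq1 (x : R) : x - A != 0 -> x / A != 1.
  by apply: contra => /eqP E; rewrite subr_eq0 -[x](divfK (lt0r_neq0 A0)) E mul1r.
have ha := powR_lt1Dx (divr_gt0 aq A0) _ w01.
have hb := powR_lt1Dx (divr_gt0 bq A0) _ w01.
have {}ha : (a `^ q / A) `^ (p / q) < 1 + p / q * (a `^ q / A - 1).
  apply/ha/neq1; apply: contra abq => /eqP; rewrite /A => h; apply/eqP; lra.
have {}hb : (b `^ q / A) `^ (p / q) < 1 + p / q * (b `^ q / A - 1).
  apply/hb/neq1; apply: contra abq => /eqP; rewrite /A => h; apply/eqP; lra.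
(* The normalised [q]-th powers have mean 1, so the linear terms cancel when the two Bernoulli
   bounds are added. *)
have E : a `^ q / A + b `^ q / A = 2.
  by rewrite -mulrDl /A; field; rewrite gt_eqF //; lra.
have powE (x : R) : 0 < x -> (x `^ q / A) `^ (p / q) = x `^ p / A `^ (p / q).
  move=> x0; rewrite powRM ?powR_ge0 ?invr_ge0 ?(ltW A0) // -powRrM.
  by rewrite mulrCA divff ?gt_eqF // mulr1 powR_invl // ltW.
have Aw := powR_gt0 (p / q) A0.
move: ha hb; rewrite !powE // => ha hb.
have lt2 : (a `^ p + b `^ p) / 2 < A `^ (p / q).
  have : (a `^ p + b `^ p) / A `^ (p / q) < 2 by rewrite mulrDl; nra.
  by rewrite ltr_pdivrMr // => ?; lra.
have -> : A `^ q^-1 = (A `^ (p / q)) `^ p^-1.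
  by rewrite -powRrM; congr powR; field; rewrite !gt_eqF.
apply: gt0_ltr_powR lt2; rewrite ?invr_gt0 ?nnegrE ?powR_ge0 //.
by rewrite divr_ge0 // addr_ge0 // powR_ge0.
Qed.

Lemma power_mean0_lt (R : realType) (q a b : R) :
  0 < a -> 0 < b -> a != b -> 0 < q ->
  power_mean 0 [:: a; b] < power_mean q [:: a; b].
Proof.
move=> a0 b0 ab q0; rewrite power_mean0_pairE power_mean_pairE ?gt_eqF //.
(* Both sides become [q^-1]-th powers. With u and v the [q / 2]-th powers of [a] and [b], what
   remains is uv < (u^2 + v^2) / 2, that is, (u - v)^2 > 0. *)
have -> : (a * b) `^ 2^-1 = (a `^ (q / 2) * b `^ (q / 2)) `^ q^-1.
  rewrite -powRM ?ltW // -powRrM; congr powR; field; exact: lt0r_neq0.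
have sq (x : R) : x `^ q = x `^ (q / 2) ^+ 2.
  by rewrite -powR_mulrn ?powR_ge0 // -powRrM divfK.
apply: gt0_ltr_powR; rewrite ?invr_gt0 ?nnegrE ?mulr_ge0 ?addr_ge0 ?powR_ge0 //.
rewrite !sq; have : 0 < (a `^ (q / 2) - b `^ (q / 2)) ^+ 2.
  rewrite exprn_even_gt0 //= subr_eq0; apply: contra ab => /eqP.
  by move/powR_injective => -> //; rewrite ?nnegrE ?ltW ?divr_gt0.
by rewrite sqrrB; lra.
Qed.

Lemma power_mean_lt_ge0 (R : realType) (p q a b : R) :
  0 < a -> 0 < b -> a != b -> 0 <= p -> p < q ->
  power_mean p [:: a; b] < power_mean q [:: a; b].
Proof.
move=> a0 b0 ab; rewrite le_eqVlt => /predU1P[<- |p0].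
  exact: power_mean0_lt.
exact: power_mean_lt_pos.
Qed.

Lemma power_mean_lt_le0 (R : realType) (p q a b : R) :
  0 < a -> 0 < b -> a != b -> q <= 0 -> p < q ->
  power_mean p [:: a; b] < power_mean q [:: a; b].
Proof.
(* Inverting the means reverses their order and negation reverses the exponents, so the claim
   becomes the one for [0 <= - q < - p]. *)
move=> a0 b0 ab q0 pq; rewrite -(opprK p) -(opprK q) !(power_meanV _ a0 b0).
rewrite ltf_pV2 ?posrE ?power_mean_gt0 ?invr_gt0 //.
by apply: power_mean_lt_ge0; rewrite ?invr_gt0 ?(inj_eq invr_inj) //; lra.
Qed.

Lemma power_mean_lt (R : realType) (p q a b : R) :
  0 < a -> 0 < b -> a != b -> p < q ->
  power_mean p [:: a; b] < power_mean q [:: a; b].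
Proof.
move=> a0 b0 ab pq; have [p0|p0] := leP 0 p; first exact: power_mean_lt_ge0.
have [q0|q0] := leP q 0; first exact: power_mean_lt_le0.
(* Exponents of opposite signs are compared through the geometric mean. *)
by apply: (@lt_trans _ _ (power_mean 0 [:: a; b]));
  [apply: power_mean_lt_le0|apply: power_mean_lt_ge0].
Qed.

Lemma power_mean_nseq2 (R : realType) (r a : R) : 0 < a ->
  power_mean r [:: a; a] = a.
Proof.
move=> a0; have [->|r0] := eqVneq r 0.
  rewrite power_mean0_pairE -expr2 -powR_mulrn ?ltW // -powRrM divff ?powRr1 //.
  exact: ltW.
have -> : power_mean r [:: a; a] = (a `^ r) `^ r^-1.
  by rewrite power_mean_pairE //; congr powR; field.
by rewrite -powRrM divff // powRr1 // ltW.
Qed.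

(** * Values of the constructive reals and the reduction from halting *)

Lemma crn_val_b_diverging (R : realType) (P : com) (n : nat) :
  (forall k, ~~ finished_by P n k) -> crn_val R (b P n) = 5.
Proof.
move=> nP; rewrite /crn_val /=; apply/cvg_lim => //.
have -> : (fun k => ratr (b_seq P n k) : R) = (fun k => 5 + 2^-1 ^+ k).
  apply/funext => k; rewrite /b_seq (negbTE (nP k)).
  by rewrite rmorphD /= fmorphV rmorphXn /= !ratr_nat exprVn.
rewrite -[X in (_ --> X)%classic]addr0; apply: cvgD; first exact: cvg_cst.
by apply: cvg_expr; rewrite ger0_norm; lra.
Qed.

Lemma crn_val_b_finishes (R : realType) (P : com) (n l v : nat) :
  finishes_at P n l v -> crn_val R (b P n) = 5 + 2^-1 ^+ l.
Proof.
move=> [fl ltl _]; rewrite /crn_val /=; apply: lim_near_cst => //.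
exists l => // k /= lk; rewrite /b_seq (finished_byS lk fl) (finish_stepE fl) //.
by rewrite rmorphD /= fmorphV rmorphXn /= !ratr_nat exprVn.
Qed.

Lemma crn_val_late_pair (R : realType) (P1 P2 : com) (n : nat) :
  one_step_late P1 P2 ->
  terminates P1 n /\ (exists a b : R, [/\ 0 < a, 0 < b, a != b,
      crn_val R (Defs.b P1 n) = a & crn_val R (Defs.b P2 n) = b]) \/
  [/\ ~ terminates P1 n, crn_val R (Defs.b P1 n) = 5 &
      crn_val R (Defs.b P2 n) = 5].
Proof.
move=> [late lateN].
have diverging P : ~ terminates P n -> forall k, ~~ finished_by P n k.
  move=> nP k; apply/negP => fk.
  (* Termination is stated with the first finishing step, so a finishing step has to be
     minimised. *)
  have ex : exists k, finished_by P n k by exists k.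
  case: (ex_minnP ex) => l fl minl; apply: nP.
  exists ((steps l (P, init n)).2 0%N), l; split=> // j jl.
  by apply/negP => /minl; rewrite leqNgt jl.
have [t1|nt1] := pselect (terminates P1 n); [left|right].
  split=> //; case: t1 => v [l P1l].
  have half : 0 < 2^-1 ^+ l :> R by rewrite exprn_gt0 // invr_gt0.
  exists (5 + 2^-1 ^+ l), (5 + 2^-1 ^+ l.+1).
  rewrite (crn_val_b_finishes R P1l) (crn_val_b_finishes R (late _ _ _ P1l)).
  by rewrite exprS; split=> //; try lra; apply/eqP; lra.
by split; rewrite ?crn_val_b_diverging //; apply: diverging => //; exact: lateN.
Qed.

Theorem theorem6 (R : realType) (P1 P2 : com)
    (P1_binary : binary_valued P1)
    (P1_nonextendable : ~ extendable P1)
    (P2_late : one_step_late P1 P2)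
    (p q : rat) (p_lt_q : p < q) :
  ~ exists D : com, forall n : nat,
      let x := [:: crn_val R (b P1 n); crn_val R (b P2 n)] in
      (outputs D n 0%N /\ power_mean (ratr p) x = power_mean (ratr q) x) \/
      (outputs D n 1%N /\ power_mean (ratr p) x < power_mean (ratr q) x).
Proof.
move=> [D decD]; apply: P1_nonextendable.
(* [D] itself decides halting: on halting inputs the means differ, which excludes answer 0; on the
   others both means are 5, which excludes answer 1. *)
apply: (@decidable_halting_extendable P1 D) => // n.
have pqR : ratr p < ratr q :> R by rewrite ltr_rat.
have := decD n; case: (crn_val_late_pair R n P2_late) => /=.
  move=> [t1 [x [y [x0 y0 xy -> ->]]]].
  case=> -[Dn E]; [exfalso|by right].
  by have := power_mean_lt x0 y0 xy pqR; rewrite E ltxx.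
move=> [nt1 -> ->]; rewrite !power_mean_nseq2 // => -[[Dn _]|[_]]; first by left.
by rewrite ltxx.
Qed.
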